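(* Let $n$ be a positive integer of the form $n = 8k+4$ with $k$ an integer. There exists an invertible $n\times n$ matrix $A_n$ with complex entries such that $$ w(A_n) \le \frac{1}{\cos\frac{\pi}{n}}, \qquad w(A_n^{-1}) \le\frac{1}{\cos\frac{\pi}{n}}, \qquad \|A_n\| = 1+\frac{1}{8\sqrt{n}} .$$
   Context: Matrices $A\in\mathbb{C}^{n\times n}$ are viewed as operators on $\mathbb{C}^n$ with its standard Hermitian inner product $\langle\cdot,\cdot\rangle$ and Euclidean norm $\|\cdot\|$. $\|A\|=\sup\{\|Ah\| : \|h\|=1\}$ is the operator norm, and $w(A)=\sup\{|\langle Ah,h\rangle| : \|h\|=1\}$ is the numerical radius. *)

(* Defs.v *)
From HB Require Import structures.
From mathcomp Require Export all_boot all_order all_algebra.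
From mathcomp Require Export sesquilinear spectral.
From mathcomp Require Export complex.
From mathcomp Require Export all_classical all_reals.
From mathcomp Require Export trigo.

Set Implicit Arguments.
Unset Strict Implicit.
Unset Printing Implicit Defensive.

Import Order.TTheory GRing.Theory Num.Theory.

Local Open Scope classical_set_scope.
Local Open Scope ring_scope.
Local Open Scope complex_scope.

(* dotmx is the Hermitian product of row vectors, antilinear in its second
   argument: hdot u v = \sum_i u i 0 * (v i 0)^* *)
Definition hdot (R : realType) (n : nat) (u v : 'cV[R[i]]_n) : R[i] :=
  dotmx u^T v^T.

(* <h, h> is a nonnegative real, so nothing is lost by taking its real part *)
Definition enorm (R : realType) (n : nat) (h : 'cV[R[i]]_n) : R :=
  Num.sqrt (complex.Re (hdot h h)).

(* For 0 < n the two sets below are nonempty and bounded, so that sup is a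
   genuine supremum; for n = 0 they are empty and sup is 0 by convention. *)
Definition opnorm (R : realType) (n : nat) (A : 'M[R[i]]_n) : R :=
  sup [set enorm (A *m h) | h in [set h | enorm h = 1]].

Definition numradius (R : realType) (n : nat) (A : 'M[R[i]]_n) : R :=
  sup [set complex.Re `|hdot (A *m h) h| | h in [set h | enorm h = 1]].

(* Main.v *)
Require Import Defs.
From mathcomp Require Import ring lra zify.
From mathcomp Require Import topology normedtype derive.

Set Implicit Arguments.
Unset Strict Implicit.
Unset Printing Implicit Defensive.

Import Order.TTheory GRing.Theory Num.Theory ComplexField.Normc.
Import numFieldNormedType.Exports.
Local Open Scope ring_scope.
Local Open Scope complex_scope.

(* Write n = 8K + 4 and, with indices starting at 0, let
   D = diag (exp (i t_j)) with t_j = (2j + 1) pi / 2n.  Let E be the circulant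
   0/1 matrix supported on 3K + 2 <= |i - j| <= 5K + 2, c = 1 / (2 n^(3/2)),
   B = 1 + c E and A = D B D.  The rows of E sum to n / 4, so that
   ||A|| = ||B|| = 1 + c n / 4 is attained at D^-1 (1, ..., 1).

   To bound w(A) it is enough to show Re (w^k <A h, h>) <= |h|^2 for every k,
   where w = exp (2 pi i / n): this puts the numerical range in a regular n-gon
   circumscribed to the unit circle.  Multiplying A by w^k replaces t_j by
   t_(j+k).  The diagonal part then contributes |h|^2 - 2 Q with
   Q = \sum_j (sin t_(j+k))^2 |h_j|^2, so the part coming from c E must be at
   most 2 Q.  When E_ij = 1 the angles t_i and t_j are not both close to a
   multiple of pi, and \sum_j (sin t_j)^-2 <= 5 n^2 / 2, whence the
   Frobenius norm of (E_ij / (sin t_i sin t_j)) bounds this part by 3 Q / 2.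
   For A^-1 = D^-1 B^-1 D^-1 one expands B^-1 = 1 - c E + c^2 E B^-1 E; the
   last term costs at most another Q / 6. *)

(** * Cauchy-Schwarz, complex moduli and the Hermitian norm *)

(** Lagrange's identity: twice the defect is a sum of squares over ordered pairs. *)
Lemma sum_CauchySchwarz (R : realType) (I : finType) (a b : I -> R) :
  (\sum_i a i * b i) ^+ 2 <= (\sum_i a i ^+ 2) * (\sum_i b i ^+ 2).
Proof.
have : 0 <= \sum_i \sum_j (a i * b j - a j * b i) ^+ 2.
  by apply: sumr_ge0 => i _; apply: sumr_ge0 => j _; apply: sqr_ge0.
have -> : \sum_i \sum_j (a i * b j - a j * b i) ^+ 2 =
    ((\sum_i a i ^+ 2) * (\sum_i b i ^+ 2) - (\sum_i a i * b i) ^+ 2) *+ 2.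
  rewrite mulr2n {2}[_ * _]mulrC expr2 !big_distrlr -!sumrB -big_split /=.
  apply: eq_bigr => i _; rewrite -!sumrB -big_split /=.
  by apply: eq_bigr => j _; ring.
by rewrite pmulrn_lge0// subr_ge0.
Qed.

Lemma sum_mul_le_sqrt (R : realType) (I : finType) (a b : I -> R) :
  \sum_i a i * b i <=
  Num.sqrt (\sum_i a i ^+ 2) * Num.sqrt (\sum_i b i ^+ 2).
Proof.
rewrite -sqrtrM; last by apply: sumr_ge0 => i _; apply: sqr_ge0.
apply: le_trans (ler_norm _) _; rewrite -sqrtr_sqr ler_wsqrtr//.
exact: sum_CauchySchwarz.
Qed.

Lemma Re_normE (R : realType) (z : R[i]) : complex.Re `|z| = normc z.
Proof. by rewrite normc_def; case: z. Qed.

Lemma normc_ge0 (R : realType) (z : R[i]) : 0 <= normc z.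
Proof. by case: z => a b; apply: sqrtr_ge0. Qed.

Lemma normc_conjc (R : realType) (z : R[i]) : normc (conjc z) = normc z.
Proof. by case: z => a b /=; rewrite sqrrN. Qed.

Lemma mulcJ (R : realType) (z : R[i]) : z * conjc z = ((normc z) ^+ 2)%:C.
Proof.
case: z => a b; rewrite /= sqr_sqrtr ?addr_ge0 ?sqr_ge0//.
by simpc; congr (_ +i* _); ring.
Qed.

Lemma Re_le_normc (R : realType) (z : R[i]) : complex.Re z <= normc z.
Proof.
case: z => a b /=; apply: le_trans (ler_norm _) _.
by rewrite -sqrtr_sqr ler_wsqrtr// lerDl sqr_ge0.
Qed.

Lemma normc_real (R : realType) (x : R) : 0 <= x -> normc x%:C = x.
Proof. by move=> x0; rewrite /= expr0n addr0 sqrtr_sqr ger0_norm. Qed.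

Lemma normc_sum (R : realType) (I : finType) (f : I -> R[i]) :
  normc (\sum_i f i) <= \sum_i normc (f i).
Proof.
elim/big_rec2: _ => [|i y x _ le_xy]; first by rewrite normc0.
by apply: le_trans (le_normcD _ _) _; rewrite lerD2l.
Qed.

Lemma Re_sum (R : realType) (I : finType) (f : I -> R[i]) :
  complex.Re (\sum_i f i) = \sum_i complex.Re (f i).
Proof. exact: (raddf_sum (@complex.Re R : Rcomplex R -> R)). Qed.

Lemma hdotE (R : realType) (n : nat) (u v : 'cV[R[i]]_n) :
  hdot u v = \sum_i u i 0 * conjc (v i 0).
Proof.
rewrite /hdot dotmxE mxE; apply: eq_bigr => i _; rewrite !mxE.
by congr (_ * _).
Qed.

Lemma enormE (R : realType) (n : nat) (u : 'cV[R[i]]_n) :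
  enorm u = Num.sqrt (\sum_i normc (u i 0) ^+ 2).
Proof.
rewrite /enorm hdotE Re_sum; congr Num.sqrt.
by apply: eq_bigr => i _; rewrite mulcJ.
Qed.

Lemma enorm_ge0 (R : realType) (n : nat) (u : 'cV[R[i]]_n) : 0 <= enorm u.
Proof. exact: sqrtr_ge0. Qed.

(* Otherwise failing unifications unfold [enorm] at a prohibitive cost. *)
#[local] Opaque enorm hdot.

Lemma enorm_sqr (R : realType) (n : nat) (u : 'cV[R[i]]_n) :
  enorm u ^+ 2 = \sum_i normc (u i 0) ^+ 2.
Proof.
by rewrite enormE sqr_sqrtr//; apply: sumr_ge0 => i _; apply: sqr_ge0.
Qed.

Lemma enorm_eq (R : realType) (n : nat) (u v : 'cV[R[i]]_n) :
  (forall i, normc (u i 0) = normc (v i 0)) -> enorm u = enorm v.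
Proof.
move=> uv; rewrite !enormE; congr Num.sqrt.
by apply: eq_bigr => i _; rewrite uv.
Qed.

Lemma enorm0_eq0 (R : realType) (n : nat) (u : 'cV[R[i]]_n) :
  enorm u = 0 -> u = 0.
Proof.
move=> u0; have /eqP := enorm_sqr u.
rewrite u0 expr0n eq_sym psumr_eq0/= => [/allP u0' |i _]; last exact: sqr_ge0.
apply/colP => i; rewrite mxE; apply: eq0_normc; apply/eqP.
by have := u0' i (mem_index_enum _); rewrite sqrf_eq0.
Qed.

Lemma normc_hdot (R : realType) (n : nat) (u v : 'cV[R[i]]_n) :
  normc (hdot u v) <= enorm u * enorm v.
Proof.
rewrite hdotE !enormE; apply: le_trans (normc_sum _) _.
under eq_bigr => i _ do rewrite normcM normc_conjc.
exact: sum_mul_le_sqrt.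
Qed.

Lemma enormD (R : realType) (n : nat) (u v : 'cV[R[i]]_n) :
  enorm (u + v) <= enorm u + enorm v.
Proof.
have sum_ge0 (w : 'cV[R[i]]_n) : 0 <= \sum_i normc (w i 0) ^+ 2.
  by apply: sumr_ge0 => i _; apply: sqr_ge0.
rewrite -(@ler_pXn2r _ 2)// ?nnegrE ?addr_ge0 ?enorm_ge0// !enormE.
set x := Num.sqrt (\sum_i normc (u i 0) ^+ 2).
set y := Num.sqrt (\sum_i normc (v i 0) ^+ 2).
rewrite (sqrrD x y) !sqr_sqrtr//.
have : \sum_i normc ((u + v) i 0) ^+ 2 <= \sum_i (normc (u i 0) ^+ 2 +
    (normc (u i 0) * normc (v i 0)) *+ 2 + normc (v i 0) ^+ 2).
  apply: ler_sum => i _; rewrite mxE -sqrrD ler_pXn2r// ?nnegrE ?normc_ge0//.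
    exact: le_normcD.
  by rewrite addr_ge0 ?normc_ge0.
move/le_trans; apply; rewrite !big_split /= lerD2r lerD2l mulr2n.
by apply: lerD; apply: sum_mul_le_sqrt.
Qed.

Lemma enormZ (R : realType) (n : nat) (a : R[i]) (u : 'cV[R[i]]_n) :
  enorm (a *: u) = normc a * enorm u.
Proof.
rewrite -[normc a](ger0_norm (normc_ge0 a)) -sqrtr_sqr !enormE.
rewrite -sqrtrM ?sqr_ge0// mulr_sumr; congr Num.sqrt.
by apply: eq_bigr => i _; rewrite mxE normcM exprMn.
Qed.

Lemma hdotDl (R : realType) (n : nat) (u v w : 'cV[R[i]]_n) :
  hdot (u + v) w = hdot u w + hdot v w.
Proof.
by rewrite !hdotE -big_split; apply: eq_bigr => i _; rewrite mxE mulrDl.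
Qed.

Lemma hdotZl (R : realType) (n : nat) (a : R[i]) (u v : 'cV[R[i]]_n) :
  hdot (a *: u) v = a * hdot u v.
Proof.
by rewrite !hdotE mulr_sumr; apply: eq_bigr => i _; rewrite mxE mulrA.
Qed.

Lemma hdotZr (R : realType) (n : nat) (a : R[i]) (u v : 'cV[R[i]]_n) :
  hdot u (a *: v) = conjc a * hdot u v.
Proof.
rewrite !hdotE mulr_sumr; apply: eq_bigr => i _.
by rewrite mxE rmorphM mulrCA.
Qed.

Lemma hdot_mulmxl (R : realType) (n : nat) (M : 'M[R[i]]_n)
    (u v : 'cV[R[i]]_n) :
  hdot (M *m u) v = hdot u (map_mx (@conjc R) M^T *m v).
Proof.
rewrite !hdotE.
under eq_bigr => i _ do rewrite mxE mulr_suml.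
rewrite exchange_big; apply: eq_bigr => j _ /=.
rewrite mxE rmorph_sum mulr_sumr; apply: eq_bigr => i _.
by rewrite !mxE rmorphM /= conjcK mulrCA mulrA.
Qed.

(** * The chord bound for the sine, and the circumscribed polygon *)

(** Concavity through the mean value theorem: the slope of the sine on [0, x] is at least its slope
    on [x, pi/2], because the cosine decreases. *)
Lemma sin_ge_chord (R : realType) (x : R) :
  0 <= x <= pi / 2 -> 2 * x / pi <= sin x.
Proof.
move=> /andP[]; rewrite le_eqVlt => /predU1P[<- _|x_gt0].
  by rewrite sin0 mulr0 mul0r.
rewrite le_eqVlt => /predU1P[->|x_lt].
  have -> : 2 * (pi / 2) / pi = 1 :> R.
    by rewrite [2 * _]mulrC divfK ?mulfV// gt_eqF ?pi_gt0.
  by rewrite sin_pihalf.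
have pi0 := pi_gt0 R.
have is_d (y : R) : is_derive y 1 (@sin R) (cos y) by exact: is_derive_sin.
have cont a b : {within `[a, b], continuous (@sin R)}%classic.
  by apply: continuous_subspaceT => y; apply: continuous_sin.
have [y1] := MVT x_gt0 (fun y _ => is_d y) (cont _ _).
rewrite in_itv /= sin0 !subr0 => /andP[y1_gt0 y1_lt] e1.
have [y2] := MVT x_lt (fun y _ => is_d y) (cont _ _).
rewrite in_itv /= sin_pihalf => /andP[y2_gt y2_lt] e2.
have le21 : cos y2 <= cos y1.
  by rewrite ltW// ltr_cos ?in_itv/=; lra.
rewrite ler_pdivrMr//.
have := ler_wpM2r (ltW x_gt0) le21; rewrite -e1 => h1.
have x2 : 0 <= pi / 2 - x by lra.
(* This is [(1 - sin x) * x <= sin x * (pi / 2 - x)]; the terms [x * sin x] cancel. *)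
have := ler_wpM2r x2 h1; rewrite mulrAC -e2; lra.
Qed.

Definition cis (R : realType) (t : R) : R[i] := cos t +i* sin t.

Lemma cisD (R : realType) (a b : R) : cis (a + b) = cis a * cis b.
Proof. by rewrite /cis cosD sinD; simpc; congr (_ +i* _); ring. Qed.

Lemma cisN (R : realType) (a : R) : cis (- a) = conjc (cis a).
Proof. by rewrite /cis cosN sinN. Qed.

Lemma normc_cis (R : realType) (t : R) : normc (cis t) = 1.
Proof. by rewrite /= cos2Dsin2 sqrtr1. Qed.

(** The argument is written [- t] with [t] nonnegative, so that rounding [t] to a multiple of 2 pi /
    n yields a natural index. *)
Lemma unit_cisN (R : realType) (z : R[i]) :
  normc z = 1 -> exists2 t : R, 0 <= t & z = cis (- t).
Proof.
case: z => a b /= /(congr1 (fun x => x ^+ 2)).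
rewrite sqr_sqrtr ?addr_ge0 ?sqr_ge0// expr1n => ab1.
have a_itv : -1 <= a <= 1 by have := sqr_ge0 b; nra.
have cosa : cos (acos a) = a by rewrite acosK ?in_itv.
have sina : sin (acos a) = `|b|.
  by rewrite sin_acos// -sqrtr_sqr; congr Num.sqrt; lra.
have [b0|b0] := lerP b 0.
  exists (acos a); first exact: acos_ge0.
  by rewrite /cis cosN sinN cosa sina ler0_norm// opprK.
exists (pi *+ 2 - acos a).
  by have := acos_lepi a_itv; have := pi_ge0 R; rewrite mulr2n; lra.
rewrite opprB /cis -cosD2pi -sinD2pi subrK cosa sina.
by rewrite ger0_norm ?ltW.
Qed.

(* The hypothesis places [z] in a regular n-gon circumscribed to the unit
   circle. *)
Lemma normc_le_ngon (R : realType) (n : nat) (s : bool) (z : R[i]) :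
  (2 < n)%N ->
  (forall k, complex.Re (cis ((-1) ^+ s * (2 * k%:R * pi / n%:R)) * z) <= 1) ->
  normc z <= 1 / cos (pi / n%:R).
Proof.
(* Conjugating [z] exchanges the two signs. *)
wlog -> : s z / s = false => [wlog_s n_gt2 zP|n_gt2 zP].
  case: s zP => zP; last exact: (wlog_s false).
  rewrite -normc_conjc; apply: (wlog_s false) => // k.
  have := zP k; rewrite expr0 expr1 mulN1r mul1r cisN.
  by case: z {zP} => a b /=; lra.
have npos : 0 < n%:R :> R by rewrite ltr0n; lia.
have pi0 := pi_gt0 R.
have pin_gt0 : 0 < (pi : R) / n%:R by rewrite divr_gt0.
have pin_lt : (pi : R) / n%:R < pi / 2.
  by rewrite ltr_pM2l// ltf_pV2 ?posrE// (ltr_nat R 2 n).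
have cos_gt0 : 0 < cos ((pi : R) / n%:R) by apply: cos_gt0_pihalf; lra.
rewrite ler_pdivlMr//.
have [->|z0] := eqVneq z 0; first by rewrite normc0 mul0r.
have nz0 : 0 < normc z.
  by rewrite lt_def normc_ge0 andbT; apply: contra_neq z0; apply: eq0_normc.
have [|t t0 zt] := @unit_cisN R (z / (normc z)%:C).
  by rewrite normcM normcV normc_real ?normc_ge0// mulfV ?gt_eqF.
have {}zt : z = (normc z)%:C * cis (- t).
  rewrite -zt mulrCA mulfV ?mulr1// -(rmorph0 (real_complex R)).
  by rewrite (inj_eq (@complexI R)) gt_eqF.
(* Adding 1/2 before truncating rounds to the nearest integer, so that the rotation by 2 k pi / n
   brings [z] within pi / n of the positive real axis. *)
pose x := t * n%:R / (2 * pi) + 1 / 2.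
have x0 : 0 <= x by rewrite addr_ge0 ?divr_ge0 ?mulr_ge0 ?ler0n ?(ltW pi0).
have /andP[k1 k2] := truncn_itv x0.
set k := Num.truncn x in k1 k2.
have zk := zP k; rewrite expr0 mul1r zt mulrCA -cisD in zk.
have {}zk : normc z * cos (2 * k%:R * pi / n%:R - t) <= 1.
  by move: zk; rewrite /cis; simpc; rewrite /=.
apply: le_trans zk; apply: ler_wpM2l; first exact: normc_ge0.
rewrite -[leRHS]cos_norm.
have tE : t = (x - 1 / 2) * (2 * (pi / n%:R)).
  have field_id (p q : R) : p != 0 -> q != 0 ->
      t = (t * q / (2 * p) + 1 / 2 - 1 / 2) * (2 * (p / q)).
    by move=> p0 q0; field; apply/andP.
  by apply: field_id; rewrite gt_eqF.
have d : `|2 * k%:R * pi / n%:R - t| <= pi / n%:R.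
  rewrite tE ler_norml; move: k2; rewrite -natr1 => k2.
  have -> : 2 * k%:R * pi / n%:R = k%:R * (2 * (pi / n%:R)) :> R by ring.
  by nra.
have d0 := normr_ge0 (2 * k%:R * pi / n%:R - t).
rewrite leNgt ltr_cos ?in_itv/= -?leNgt//; lra.
Qed.

(** * Sums of inverse squared sines *)

Lemma sum_ord_shift (V : nmodType) (m k : nat) (F : nat -> V) :
  \sum_(i < m.+1) F ((i + k) %% m.+1)%N = \sum_(i < m.+1) F i.
Proof.
rewrite [RHS](reindex_inj (addIr (inZp k : 'I_m.+1))) /=.
by apply: eq_bigr => i _; rewrite modnDmr.
Qed.

(** Telescoping: 1/(2x+1)^2 is at most (1/x - 1/(x+1))/4 for x >= 1, and the term of index 0 is 1 =
    5/4 - 1/4. *)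
Lemma sum_odd_sqrV (R : realType) (n : nat) :
  \sum_(i < n.+1) ((2 * i%:R + 1) ^+ 2)^-1 <= 5 / 4 - (4 * n.+1%:R)^-1 :> R.
Proof.
elim: n => [|n IHn].
  by rewrite big_ord1 mulr0 add0r expr1n invr1 mulr1; lra.
rewrite big_ord_recr /=; apply: le_trans (lerD IHn (lexx _)) _.
rewrite -(natr1 n.+1); set x : R := n.+1%:R.
have x0 : 0 < x by rewrite ltr0n.
have -> : (4 * x)^-1 = (4 * (x + 1))^-1 + (4 * x * (x + 1))^-1.
  by field; apply/andP; split; apply: lt0r_neq0; lra.
have : ((2 * x + 1) ^+ 2)^-1 <= (4 * x * (x + 1))^-1.
  by rewrite lef_pV2 ?posrE; nra.
by move: ((2 * x + 1) ^- 2) (_ * (x + 1))^-1 (4 * (x + 1))^-1 => a b c; lra.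
Qed.

Notation dim K := (8 * K + 3).+1.

(** The index is any natural number, so that a rotation by w^k becomes the plain shift [i + k].
    Adding n to the index adds pi, which the squared sine does not see. *)
Definition angle (R : realType) (K t : nat) : R :=
  (2 * t%:R + 1) * (pi / (2 * (dim K)%:R)).

Definition sin2 (R : realType) (K t : nat) : R := sin (angle R K t) ^+ 2.

Lemma angleD (R : realType) (K s t : nat) :
  angle R K (s + t) = angle R K s + t%:R * pi / (dim K)%:R.
Proof.
rewrite /angle natrD.
have aux (p q x y : R) : q != 0 ->
    (2 * (x + y) + 1) * (p / (2 * q)) = (2 * x + 1) * (p / (2 * q)) + y * p / q.
  by move=> q0; field.
by apply: aux; rewrite pnatr_eq0.
Qed.

Lemma sin2_mod (R : realType) (K t : nat) : sin2 R K (t %% dim K) = sin2 R K t.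
Proof.
have sin2DM q r : sin2 R K (r + q * dim K) = sin2 R K r.
  elim: q => [|q IHq]; first by rewrite mul0n addn0.
  rewrite mulSnr addnA -{}IHq /sin2 angleD [_%:R * pi]mulrC mulfK ?pnatr_eq0//.
  by rewrite sinDpi sqrrN.
by rewrite [in RHS](divn_eq t (dim K)) -(sin2DM (t %/ dim K)%N) addnC.
Qed.

Lemma sin2_rev (R : realType) (K t : nat) : (t < dim K)%N ->
  sin2 R K (dim K - t.+1) = sin2 R K t.
Proof.
move=> t_lt; rewrite /sin2.
have -> : angle R K (dim K - t.+1) = pi - angle R K t.
  rewrite /angle natrB// -[in LHS](natr1 t).
  have aux (p q x : R) : q != 0 -> (2 * (q - (x + 1)) + 1) * (p / (2 * q)) =
      p - (2 * x + 1) * (p / (2 * q)) by move=> q0; field.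
  by apply: aux; rewrite pnatr_eq0.
by rewrite addrC sinDpi sinN opprK.
Qed.

(** The chord bound applies because the hypothesis puts the angle in the first quadrant. *)
Lemma sin2_ge (R : realType) (K t : nat) : (t.*2 < dim K)%N ->
  ((2 * t%:R + 1) / (dim K)%:R) ^+ 2 <= sin2 R K t.
Proof.
move=> t_lt; have n0 : 0 < (dim K)%:R :> R by rewrite ltr0n.
have pi0 := pi_gt0 R; have t0 : 0 <= t%:R :> R by rewrite ler0n.
have le_tn : 2 * t%:R + 1 <= (dim K)%:R :> R.
  by rewrite -natrM natr1 ler_nat mul2n.
have le_chord : (2 * t%:R + 1) / (dim K)%:R <= sin (angle R K t).
  have := @sin_ge_chord R (angle R K t).
  have -> : 2 * angle R K t / pi = (2 * t%:R + 1) / (dim K)%:R.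
    have aux (p q x : R) : p != 0 -> q != 0 ->
      2 * ((2 * x + 1) * (p / (2 * q))) / p = (2 * x + 1) / q.
      by move=> p0 q0; field; apply/andP.
    by apply: aux; rewrite gt_eqF.
  apply; apply/andP; split; rewrite /angle.
    by rewrite mulr_ge0 ?addr_ge0 ?divr_ge0 ?mulr_ge0 ?pi_ge0.
  rewrite invfM (mulrA pi) (mulrC _ (dim K)%:R^-1) mulrA.
  rewrite ler_piMl ?divr_ge0 ?pi_ge0//.
  by rewrite ler_pdivrMr// mul1r.
rewrite /sin2 ler_pXn2r// nnegrE; last first.
  by apply: le_trans le_chord; rewrite divr_ge0 ?addr_ge0 ?mulr_ge0// ltW.
by rewrite divr_ge0 ?addr_ge0 ?mulr_ge0// ltW.
Qed.

(** Periodicity and reflection reduce to the first quadrant, where the odd numerator [2 * t + 1]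
    keeps the chord bound positive. *)
Lemma sin2_gt0 (R : realType) (K t : nat) : 0 < sin2 R K t.
Proof.
wlog t_lt : t / (t.*2 < dim K)%N => [wlog_t|].
  rewrite -sin2_mod; set r := (t %% _)%N.
  have r_lt : (r < dim K)%N by rewrite ltn_mod.
  have [|r_ge] := ltnP r.*2 (dim K); first exact: wlog_t.
  by rewrite -sin2_rev//; apply: wlog_t; lia.
apply: lt_le_trans (sin2_ge R t_lt); rewrite exprn_gt0// divr_gt0 ?ltr0n//.
by rewrite ltr_wpDl// mulr_ge0.
Qed.

Lemma sum_sin2V (R : realType) (K k : nat) :
  \sum_(i < dim K) (sin2 R K (i + k))^-1 <= 5 / 2 * (dim K)%:R ^+ 2.
Proof.
under eq_bigr => i _ do rewrite -sin2_mod.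
rewrite (sum_ord_shift _ k (fun t => (sin2 R K t)^-1)).
pose f t : R := ((2 * t%:R + 1) ^+ 2)^-1.
have f0 t : 0 <= f t by rewrite invr_ge0 sqr_ge0.
have le_f t : (t.*2 < dim K)%N -> (sin2 R K t)^-1 <= (dim K)%:R ^+ 2 * f t.
  move=> t_lt; have := sin2_ge R t_lt; rewrite expr_div_n => le_s.
  rewrite -[X in X * _]invrK -invfM mulrC lef_pV2// posrE ?sin2_gt0//.
  by rewrite divr_gt0 ?exprn_gt0 ?ltr0n// ltr_wpDl ?mulr_ge0.
(* One of an index and its mirror image lies in the first half. Keeping both terms gives twice n^2 *
   5/4. *)
have le_ff (i : 'I_(dim K)) :
    (sin2 R K i)^-1 <= (dim K)%:R ^+ 2 * (f i + f (rev_ord i)).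
  rewrite mulrDr; have [i_lt|i_ge] := ltnP i.*2 (dim K).
    by rewrite (le_trans (le_f _ i_lt))// lerDl mulr_ge0 ?sqr_ge0.
  rewrite -sin2_rev// (@le_trans _ _ ((dim K)%:R ^+ 2 * f (rev_ord i)))//.
    by apply: le_f; lia.
  by rewrite lerDr mulr_ge0 ?sqr_ge0.
apply: le_trans (ler_sum _ (fun i _ => le_ff i)) _.
rewrite -mulr_sumr mulrC ler_pM2r ?exprn_gt0 ?ltr0n// big_split /=.
have -> : \sum_(i < dim K) f (rev_ord i) = \sum_(i < dim K) f i.
  by rewrite [RHS](reindex_inj rev_ord_inj).
have le_sum : \sum_(i < dim K) f i <= _ := sum_odd_sqrV R _.
have n_ge0 : 0 <= (4 * (dim K)%:R)^-1 :> R by rewrite invr_ge0 mulr_ge0.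
by move: (\sum_(i < dim K) f i) (4 * _)^-1 le_sum n_ge0 => x y; lra.
Qed.

(** * The circulant graph supporting E *)

(** With truncated subtraction the middle term is |i - j|. The two bounds add up to n, which makes
    the relation invariant under cyclic shifts. *)
Definition adj (K : nat) : rel 'I_(dim K) :=
  fun i j => (3 * K + 2 <= (i - j) + (j - i) <= 5 * K + 2)%N.

Lemma adj_sym (K : nat) : symmetric (@adj K).
Proof. by move=> i j; rewrite /adj [(i - j + _)%N]addnC. Qed.

(** A cyclic shift by [i] turns the neighbours of [i] into the interval [3K+2, 5K+2]; the symmetry
    of this window under t -> n - t absorbs the wraparound. *)
Lemma adj_degree (K : nat) (i : 'I_(dim K)) :
  (\sum_(j < dim K) adj i j = 2 * K + 1)%N.
Proof.
pose F (t : nat) : nat := (3 * K + 2 <= (i - t) + (t - i) <= 5 * K + 2)%N.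
rewrite -[LHS]/(\sum_(j < dim K) F j)%N -(sum_ord_shift _ i F).
pose G (t : nat) : nat := (3 * K + 2 <= t <= 5 * K + 2)%N.
have FG (j : 'I_(dim K)) : F ((j + i) %% dim K)%N = G j.
  rewrite /F /G; congr nat_of_bool.
  have i_lt := ltn_ord i; have j_lt := ltn_ord j.
  have [ji|ji] := ltnP (j + i) (dim K).
    by rewrite modn_small//; apply/idP/idP; lia.
  rewrite -(subnK ji) modnDr modn_small; first by apply/idP/idP; lia.
  lia.
rewrite (eq_bigr _ (fun j _ => FG j)) -(big_mkord xpredT G).
rewrite (@big_cat_nat _ _ _ (3 * K + 2))//=; last lia.
rewrite (@big_cat_nat _ _ _ (5 * K + 3) (3 * K + 2))//=; [|lia|lia].
have G0 a b : (b <= 3 * K + 2)%N || (5 * K + 3 <= a)%N ->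
    (\sum_(a <= t < b) G t = 0)%N.
  by move=> ab; rewrite big_nat big1// /G => t; lia.
rewrite (G0 0%N) ?leqnn// (G0 (5 * K + 3)%N) ?leqnn ?orbT// add0r addr0.
rewrite (eq_big_nat _ _ (F2 := fun=> 1%N)).
  by rewrite sum_nat_const_nat; lia.
by rewrite /G => t; lia.
Qed.

(** Residues r with 2r+1 outside [3K+2, 13K+6] form an arc around 0 of cyclic diameter below 3K+2,
    so it cannot contain two neighbours. Inside, up to reflection, (2r+1)/n >= 3/8, whose square is
    9/64. *)
Lemma adj_sin2 (R : realType) (K k : nat) (i j : 'I_(dim K)) : adj i j ->
  9 / 64 <= sin2 R K (i + k) \/ 9 / 64 <= sin2 R K (j + k).
Proof.
move=> adj_ij; rewrite -(sin2_mod R K (i + k)) -(sin2_mod R K (j + k)).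
have ge_mid t : (t < dim K)%N -> (3 * K + 2 <= t.*2.+1 <= 13 * K + 6)%N ->
    9 / 64 <= sin2 R K t.
  wlog t_lt : t / (t.*2 < dim K)%N => [wlog_t t_lt t_mid|_ /andP[t_ge _]].
    have [|t_ge] := ltnP t.*2 (dim K); first by move=> /wlog_t; apply.
    by rewrite -sin2_rev//; apply: wlog_t; lia.
  apply: le_trans (sin2_ge R t_lt).
  have -> : 9 / 64 = (3 / 8) ^+ 2 :> R by field.
  rewrite ler_pXn2r ?nnegrE ?divr_ge0 ?addr_ge0 ?mulr_ge0//.
  rewrite ler_pdivlMr ?ltr0n// mulrAC ler_pdivrMr// -natrM natr1.
  rewrite -!natrM ler_nat; lia.
have ltr : ((i + k) %% dim K < dim K)%N by rewrite ltn_mod.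
have ltr' : ((j + k) %% dim K < dim K)%N by rewrite ltn_mod.
set r := ((i + k) %% dim K)%N in ltr *.
set r' := ((j + k) %% dim K)%N in ltr' *.
(* Reduction modulo n preserves the difference of the indices up to one full turn, since the
   quotients differ by at most one. *)
have r_or : (r + j = r' + i \/ r + j = r' + i + dim K \/
    r + j + dim K = r' + i)%N.
  have i_lt := ltn_ord i; have j_lt := ltn_ord j.
  have := divn_eq (i + k) (dim K); have := divn_eq (j + k) (dim K).
  rewrite -/r -/r'; set q := (_ %/ _)%N; set q' := (_ %/ _)%N => ejk eik.
  have lt_q : (q < q' + 2)%N by rewrite -(ltn_pmul2r (_ : 0 < dim K)%N)//; lia.
  have lt_q' : (q' < q + 2)%N by rewrite -(ltn_pmul2r (_ : 0 < dim K)%N)//; lia.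
  have [e|[e|e]] : (q' = q \/ q' = q.+1 \/ q = q'.+1)%N by lia.
  - by left; rewrite e in eik; lia.
  - by right; right; rewrite e (mulSn q (dim K)) in eik; lia.
  - by right; left; rewrite e (mulSn q' (dim K)) in ejk; lia.
move: adj_ij; rewrite /adj => adj_ij.
have [r_mid|r_out] := boolP (3 * K + 2 <= r.*2.+1 <= 13 * K + 6)%N.
  by left; apply: ge_mid.
by right; apply: ge_mid => //; have := ltn_ord i; have := ltn_ord j; lia.
Qed.

(** * The constant c and real quadratic estimates *)

(** Chosen so that c times the row sum n / 4 is the excess 1 / (8 sqrt n) of the norm over 1. *)
Definition coupling (R : realType) (K : nat) : R :=
  (2 * (dim K)%:R * Num.sqrt (dim K)%:R)^-1.

Lemma coupling_gt0 (R : realType) (K : nat) : 0 < coupling R K.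
Proof. by rewrite invr_gt0 !mulr_gt0 ?sqrtr_gt0 ?ltr0n. Qed.

Lemma coupling_sqr (R : realType) (K : nat) :
  coupling R K ^+ 2 = (4 * (dim K)%:R ^+ 3)^-1.
Proof.
rewrite /coupling exprVn !exprMn sqr_sqrtr ?ler0n//; congr (_^-1).
by rewrite [in RHS]exprSr mulrA; congr (_ * _ * _); ring.
Qed.

(** The form Q for the shift [k], on real weights because only the moduli of the entries enter. *)
Definition energy (R : realType) (K k : nat) (a : 'I_(dim K) -> R) : R :=
  \sum_(i < dim K) sin2 R K (i + k) * a i ^+ 2.

Lemma energy_ge0 (R : realType) (K k : nat) (a : 'I_(dim K) -> R) :
  0 <= energy k a.
Proof.
by apply: sumr_ge0 => i _; rewrite mulr_ge0 ?sqr_ge0 ?(ltW (sin2_gt0 _ _ _)).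
Qed.

Lemma adj_degreeR (R : realType) (K : nat) (i : 'I_(dim K)) :
  \sum_(j < dim K) (adj i j)%:R = (dim K)%:R / 4 :> R.
Proof.
rewrite -natr_sum adj_degree.
have -> : dim K = ((2 * K + 1) * 4)%N by lia.
by rewrite [in RHS]natrM mulfK ?pnatr_eq0.
Qed.

(** Each [j] has n / 4 neighbours, and n/4 * 5/2 n^2 = 5/8 n^3. *)
Lemma adj_sum_sin2V (R : realType) (K k : nat) :
  \sum_(i < dim K) \sum_(j < dim K) (adj i j)%:R * (sin2 R K (j + k))^-1 <=
  5 / 8 * (dim K)%:R ^+ 3.
Proof.
rewrite exchange_big /=.
under eq_bigr => j _ do (under eq_bigr => i _ do rewrite adj_sym;
  rewrite -mulr_suml adj_degreeR).
rewrite -mulr_sumr.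
have := sum_sin2V R K k; set S := \sum_(i < _) _ => leS.
have := ler_wpM2l (ler0n R (dim K)) leS; set n : R := (dim K)%:R; lra.
Qed.

(** On an adjacent pair one factor is at most 64/9, so the product is at most 64/9 times the sum of
    the two factors; then 2 * 64/9 * 5/8 = 80/9. *)
Lemma adj_sum_sin2V2 (R : realType) (K k : nat) :
  \sum_(i < dim K) \sum_(j < dim K)
    (adj i j)%:R * ((sin2 R K (i + k))^-1 * (sin2 R K (j + k))^-1) <=
  80 / 9 * (dim K)%:R ^+ 3.
Proof.
set s := fun i : 'I_(dim K) => (sin2 R K (i + k))^-1.
have s0 i : 0 <= s i by rewrite invr_ge0 (ltW (sin2_gt0 _ _ _)).
have le_s i j : (adj i j)%:R * (s i * s j) <=
    64 / 9 * ((adj i j)%:R * s i) + 64 / 9 * ((adj i j)%:R * s j).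
  case: (boolP (adj i j)) => [ij|_]; last by rewrite !mul0r !mulr0 addr0.
  have sV (l : 'I_(dim K)) : 9 / 64 <= sin2 R K (l + k) -> s l <= 64 / 9.
    by move=> le_l; rewrite -(invf_div 9) lef_pV2 ?posrE ?sin2_gt0 ?divr_gt0.
  rewrite /= !mul1r; have [/sV le_i|/sV le_j] := adj_sin2 R k ij.
    by have := ler_wpM2r (s0 j) le_i; have := s0 i; lra.
  by have := ler_wpM2l (s0 i) le_j; have := s0 j; lra.
apply: (@le_trans _ _ (\sum_i \sum_j (64 / 9 * ((adj i j)%:R * s i) +
    64 / 9 * ((adj i j)%:R * s j)))).
  by apply: ler_sum => i _; apply: ler_sum => j _; apply: le_s.
under eq_bigr => i _ do rewrite big_split -!mulr_sumr /=.
rewrite big_split -!mulr_sumr /=.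
have le_j := adj_sum_sin2V R K k.
have -> : \sum_(i < dim K) \sum_(j < dim K) (adj i j)%:R * s i =
    \sum_(i < dim K) \sum_(j < dim K) (adj i j)%:R * s j.
  rewrite exchange_big; apply: eq_bigr => i _; apply: eq_bigr => j _ /=.
  by rewrite adj_sym.
by rewrite /s; move: le_j; set S := \sum_(i < _) _; lra.
Qed.

(** Cauchy-Schwarz over pairs, each entry of E divided by the two sines. Since c^2 = 1 / (4 n^3),
    the squared constant is 80/36, which is below (3/2)^2. *)
Lemma adj_form_le (R : realType) (K k : nat) (a : 'I_(dim K) -> R) :
  coupling R K * (\sum_i \sum_j (adj i j)%:R * (a i * a j)) <=
  3 / 2 * energy k a.
Proof.
pose s (i : 'I_(dim K)) := sin (angle R K (i + k)).
have s0 i : s i != 0 by have := sin2_gt0 R K (i + k); rewrite exprn_even_gt0.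
pose f (p : 'I_(dim K) * 'I_(dim K)) : R := (adj p.1 p.2)%:R / (s p.1 * s p.2).
pose g (p : 'I_(dim K) * 'I_(dim K)) : R := (s p.1 * a p.1) * (s p.2 * a p.2).
set F := \sum_i _.
have eF : F = \sum_p f p * g p.
  rewrite /F pair_big; apply: eq_bigr => -[i j] _; rewrite /f /g /=.
  by field; rewrite !s0.
have ef : \sum_p f p ^+ 2 <= 80 / 9 * (dim K)%:R ^+ 3.
  apply: le_trans (adj_sum_sin2V2 R K k); rewrite pair_big /=.
  apply: ler_sum => -[i j] _; rewrite /f /= exprMn exprVn exprMn invfM.
  by case: (adj i j); rewrite /= ?expr1n ?expr0n ?mul0r.
have eg : \sum_p g p ^+ 2 = energy k a ^+ 2.
  rewrite [RHS]expr2 /energy big_distrlr /= pair_big.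
  by apply: eq_bigr => -[i j] _; rewrite /g /= !exprMn.
have := sum_CauchySchwarz f g; rewrite -eF eg => leF.
have [F0|F0] := lerP F 0.
  apply: (@le_trans _ _ 0); last by rewrite mulr_ge0 ?energy_ge0 ?divr_ge0.
  by rewrite mulr_ge0_le0// ltW ?coupling_gt0.
have cF0 : 0 <= coupling R K * F by rewrite mulr_ge0 ?ltW ?coupling_gt0.
have e0 : 0 <= 3 / 2 * energy k a by rewrite mulr_ge0 ?energy_ge0 ?divr_ge0.
rewrite -(@ler_pXn2r _ 2)//.
rewrite !exprMn coupling_sqr.
have n0 : 0 < 4 * (dim K)%:R ^+ 3 :> R by rewrite mulr_gt0 ?exprn_gt0 ?ltr0n.
rewrite ler_pdivrMl//; apply: le_trans leF _.
apply: le_trans (ler_wpM2r (sqr_ge0 _) ef) _.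
move: (energy k a ^+ 2) ((dim K)%:R ^+ 3) (sqr_ge0 (energy k a)) n0.
move=> e n e1 n0.
by have : 0 <= n * e; [apply: mulr_ge0; lra|lra].
Qed.

(** Cauchy-Schwarz in each row with the sine of the column index as weight; 5/8 divided by 4 is
    5/32. *)
Lemma adj_sqr_le (R : realType) (K k : nat) (a : 'I_(dim K) -> R) :
  coupling R K ^+ 2 * (\sum_i (\sum_j (adj i j)%:R * a j) ^+ 2) <=
  5 / 32 * energy k a.
Proof.
pose s (i : 'I_(dim K)) := sin (angle R K (i + k)).
have s0 i : s i != 0 by have := sin2_gt0 R K (i + k); rewrite exprn_even_gt0.
have leF : \sum_(i < dim K) (\sum_j (adj i j)%:R * a j) ^+ 2 <=
    5 / 8 * (dim K)%:R ^+ 3 * energy k a.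
  apply: le_trans (ler_wpM2r (energy_ge0 k a) (adj_sum_sin2V R K k)).
  rewrite mulr_suml; apply: ler_sum => i _.
  have := sum_CauchySchwarz (fun j => (adj i j)%:R / s j) (fun j => s j * a j).
  under eq_bigr => j _ do rewrite mulrA divfK//.
  move/le_trans; apply; rewrite le_eqVlt; apply/orP; left; apply/eqP.
  congr (_ * _); apply: eq_bigr => j _; rewrite exprMn ?exprVn//.
  by case: (adj i j); rewrite /= ?expr1n ?expr0n ?mul0r.
rewrite coupling_sqr.
have n0 : 0 < 4 * (dim K)%:R ^+ 3 :> R by rewrite mulr_gt0 ?exprn_gt0 ?ltr0n.
by rewrite ler_pdivrMl//; apply: le_trans leF _; lra.
Qed.

(** * The matrix E acting on complex vectors *)

Definition adjmx (R : realType) (K : nat) : 'M[R[i]]_(dim K) :=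
  \matrix_(i, j) (adj i j)%:R.

Lemma normc_adjmx (R : realType) (K : nat) (i j : 'I_(dim K)) :
  normc (adjmx R K i j) = (adj i j)%:R.
Proof. by rewrite mxE -(rmorph_nat (real_complex R)) normc_real. Qed.

Lemma normc_adjmx_mul (R : realType) (K : nat) (u : 'cV[R[i]]_(dim K)) i :
  normc ((adjmx R K *m u) i 0) <= \sum_j (adj i j)%:R * normc (u j 0).
Proof.
rewrite mxE; apply: le_trans (normc_sum _) _.
by apply: ler_sum => j _; rewrite normcM normc_adjmx.
Qed.

Lemma enorm_adjmx_energy (R : realType) (K k : nat) (u : 'cV[R[i]]_(dim K)) :
  coupling R K ^+ 2 * enorm (adjmx R K *m u) ^+ 2 <=
  5 / 32 * energy k (fun i => normc (u i 0)).
Proof.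
apply: le_trans (adj_sqr_le k _); rewrite ler_wpM2l ?sqr_ge0// enorm_sqr.
apply: ler_sum => i _; have le_i := normc_adjmx_mul u i.
rewrite ler_pXn2r ?nnegrE ?normc_ge0//; exact: le_trans (normc_ge0 _) le_i.
Qed.

(** Schur test: the row sums give one factor n / 4 of the squared norm, the column sums the
    other. *)
Lemma enorm_adjmx (R : realType) (K : nat) (u : 'cV[R[i]]_(dim K)) :
  enorm (adjmx R K *m u) <= (dim K)%:R / 4 * enorm u.
Proof.
set d : R := _ / 4; have d0 : 0 <= d by rewrite divr_ge0.
have := enorm_sqr u; have := enorm_sqr (adjmx R K *m u).
have := enorm_ge0 u; have := enorm_ge0 (adjmx R K *m u).
move: (enorm u) (enorm (_ *m u)) => x y y0 x0 ey ex.
rewrite -(@ler_pXn2r _ 2)// ?nnegrE ?(mulr_ge0 d0 x0)//.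
rewrite exprMn ex ey => {x y x0 y0 ex ey}.
apply: (@le_trans _ _ (\sum_i d * \sum_j (adj i j)%:R * normc (u j 0) ^+ 2)).
  apply: ler_sum => i _; have le_i := normc_adjmx_mul u i.
  apply: (@le_trans _ _ ((\sum_j (adj i j)%:R * normc (u j 0)) ^+ 2)).
    rewrite ler_pXn2r ?nnegrE ?normc_ge0//; exact: le_trans (normc_ge0 _) le_i.
  have adj2 j : (adj i j)%:R ^+ 2 = (adj i j)%:R :> R.
    by case: (adj i j); rewrite /= ?expr1n ?expr0n.
  have := sum_CauchySchwarz (fun j => (adj i j)%:R : R)
    (fun j => (adj i j)%:R * normc (u j 0)).
  under eq_bigr => j _ do rewrite mulrA -expr2 adj2.
  under [X in _ <= X * _ -> _]eq_bigr => j _ do rewrite adj2.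
  under [X in _ <= _ * X -> _]eq_bigr => j _ do rewrite exprMn adj2.
  by rewrite adj_degreeR.
rewrite -mulr_sumr exchange_big /= expr2 -mulrA ler_wpM2l// mulr_sumr.
apply: ler_sum => j _; rewrite -mulr_suml.
by under eq_bigr => i _ do rewrite adj_sym; rewrite adj_degreeR.
Qed.

Lemma adjmx_selfadjoint (R : realType) (K : nat) (u v : 'cV[R[i]]_(dim K)) :
  hdot (adjmx R K *m u) v = hdot u (adjmx R K *m v).
Proof.
have adjmx_adj : map_mx (@conjc R) (adjmx R K)^T = adjmx R K.
  by apply/matrixP => i j; rewrite !mxE adj_sym rmorph_nat.
by rewrite (hdot_mulmxl (adjmx R K)) adjmx_adj.
Qed.

(** The entries of E are nonnegative, so only moduli matter; [u] and [v] will be one vector carrying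
    different phases. *)
Lemma hdot_adjmx_le (R : realType) (K k : nat) (u v : 'cV[R[i]]_(dim K)) :
  (forall i, normc (u i 0) = normc (v i 0)) ->
  coupling R K * normc (hdot (adjmx R K *m u) v) <=
  3 / 2 * energy k (fun i => normc (u i 0)).
Proof.
move=> uv; apply: le_trans (adj_form_le k _).
rewrite ler_wpM2l ?(ltW (coupling_gt0 _ _))// hdotE.
apply: le_trans (normc_sum _) _; apply: ler_sum => i _.
rewrite normcM normc_conjc -uv.
apply: le_trans (ler_wpM2r (normc_ge0 _) (normc_adjmx_mul u i)) _.
by rewrite mulr_suml; apply: ler_sum => j _; rewrite -mulrA [_ * normc _]mulrC.
Qed.

Lemma coupling_degree (R : realType) (K : nat) :
  coupling R K * ((dim K)%:R / 4) = 1 / (8 * Num.sqrt (dim K)%:R).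
Proof.
have n0 : (dim K)%:R != 0 :> R by rewrite pnatr_eq0.
have s0 : Num.sqrt (dim K)%:R != 0 :> R by rewrite gt_eqF ?sqrtr_gt0 ?ltr0n.
have field_id (s n : R) : s != 0 -> n != 0 ->
    (2 * n * s)^-1 * (n / 4) = 1 / (8 * s).
  by move=> ? ?; field; apply/andP.
exact: field_id.
Qed.

Lemma coupling_degree_le (R : realType) (K : nat) :
  coupling R K * ((dim K)%:R / 4) <= 1 / 16.
Proof.
rewrite coupling_degree !div1r lef_pV2 ?posrE ?mulr_gt0 ?sqrtr_gt0 ?ltr0n//.
have : 2 <= Num.sqrt (dim K)%:R :> R.
  have -> : 2 = Num.sqrt (2 ^+ 2) :> R by rewrite sqrtr_sqr ger0_norm.
  by rewrite ler_wsqrtr// -natrX ler_nat; lia.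
lra.
Qed.

(** * The matrix B, its inverse, and their distance to the identity *)

Definition coremx (R : realType) (K : nat) : 'M[R[i]]_(dim K) :=
  1%:M + (coupling R K)%:C *: adjmx R K.

Lemma coremx_mul (R : realType) (K : nat) (u : 'cV[R[i]]_(dim K)) :
  coremx R K *m u = u + (coupling R K)%:C *: (adjmx R K *m u).
Proof. by rewrite mulmxDl mul1mx scalemxAl. Qed.

Lemma enorm_coupling_adjmx (R : realType) (K : nat) (u : 'cV[R[i]]_(dim K)) :
  enorm ((coupling R K)%:C *: (adjmx R K *m u)) <=
  coupling R K * ((dim K)%:R / 4) * enorm u.
Proof.
rewrite enormZ.
rewrite (normc_real (ltW (coupling_gt0 R K))).
rewrite -mulrA.
by rewrite ler_wpM2l ?enorm_adjmx// ltW ?coupling_gt0.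
Qed.

Lemma enorm_coremx_le (R : realType) (K : nat) (u : 'cV[R[i]]_(dim K)) :
  enorm (coremx R K *m u) <= (1 + 1 / (8 * Num.sqrt (dim K)%:R)) * enorm u.
Proof.
rewrite coremx_mul -coupling_degree; apply: le_trans (enormD _ _) _.
by rewrite mulrDl mul1r lerD2l enorm_coupling_adjmx.
Qed.

(** In u = B u - c E u the last term has norm at most |u| / 16 and is absorbed on the left; 16/15 =
    1 / (1 - 1/16). *)
Lemma enorm_coremx_ge (R : realType) (K : nat) (u : 'cV[R[i]]_(dim K)) :
  enorm u <= 16 / 15 * enorm (coremx R K *m u).
Proof.
have absorb (d x y z : R) :
  d <= 1 / 16 -> 0 <= x -> x <= y + z -> z <= d * x -> x <= 16 / 15 * y.
  by move=> d_le x0 x_le z_le; have := ler_wpM2r x0 d_le; lra.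
have eu : u = coremx R K *m u + (-1) *: ((coupling R K)%:C *: (adjmx R K *m u)).
  by rewrite coremx_mul scaleN1r addrK.
have := enormD (coremx R K *m u)
  ((-1) *: ((coupling R K)%:C *: (adjmx R K *m u))).
rewrite -eu (enormZ (-1)) normcN normc1 mul1r => le_u.
exact: absorb (coupling_degree_le R K) (enorm_ge0 u) le_u
  (enorm_coupling_adjmx u).
Qed.

Lemma coremx_unit (R : realType) (K : nat) : coremx R K \in unitmx.
Proof.
rewrite -unitmx_tr unitmxE unitfE; apply/det0P => -[v v0 vB].
have Bv : coremx R K *m v^T = 0 by rewrite -[LHS]trmxK trmx_mul trmxK vB trmx0.
have := enorm_coremx_ge v^T; rewrite Bv.
have -> : enorm (0 : 'cV[R[i]]_(dim K)) = 0.
  by rewrite -(scale0r 0) enormZ normc0 mul0r.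
rewrite mulr0 => le0; move/eqP: v0; apply.
apply: trmx_inj; rewrite trmx0; apply: enorm0_eq0.
by apply: le_anti; rewrite le0 enorm_ge0.
Qed.

(** Substitute V = 1 - c V E into V = 1 - c E V. The outer E of the second-order term can then be
    moved to the other argument of the Hermitian product. *)
Lemma invmx_coremx_mul (R : realType) (K : nat) (u : 'cV[R[i]]_(dim K)) :
  (invmx (coremx R K) - 1%:M) *m u =
  - (coupling R K)%:C *: (adjmx R K *m u) +
  ((coupling R K)%:C ^+ 2) *:
    (adjmx R K *m (invmx (coremx R K) *m (adjmx R K *m u))).
Proof.
have VB := mulVmx (coremx_unit R K); have BV := mulmxV (coremx_unit R K).
set V := invmx _ in VB BV *; set c := _%:C; set E := adjmx R K.
have V1 : V = 1%:M - c *: (V *m E).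
  by rewrite -[1%:M in RHS]VB mulmxDr mulmx1 -scalemxAr addrK.
have V2 : V = 1%:M - c *: (E *m V).
  by rewrite -[1%:M in RHS]BV mulmxDl mul1mx -scalemxAl addrK.
have -> : V - 1%:M = - c *: E + c ^+ 2 *: (E *m (V *m E)).
  rewrite {1}V2 {1}V1 mulmxBr mulmx1 scalerBr addrAC subrr add0r.
  by rewrite opprB addrC scaleNr -scalemxAr scalerA.
by rewrite mulmxDl -!scalemxAl !mulmxA.
Qed.

(** The first-order term costs 3/2 Q. The other is c^2 <V E u, E v>, at most c^2 * 16/15 * |E u| |E
    v|, hence by the arithmetic-geometric mean inequality 16/15 * 5/32 Q = Q / 6. *)
Lemma hdot_invmx_coremx_le (R : realType) (K k : nat)
    (u v : 'cV[R[i]]_(dim K)) :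
  (forall i, normc (u i 0) = normc (v i 0)) ->
  normc (hdot ((invmx (coremx R K) - 1%:M) *m u) v) <=
  2 * energy k (fun i => normc (u i 0)).
Proof.
move=> uv.
have amgm (x y z w : R) : x <= y * w -> y <= 16 / 15 * z -> 0 <= w ->
    x <= 8 / 15 * z ^+ 2 + 8 / 15 * w ^+ 2.
  move=> x_le y_le w0; have := ler_wpM2r w0 y_le.
  by have := sqr_ge0 (z - w); rewrite sqrrB -mulr_natr; lra.
have combine (c x y p q e : R) : c * x <= 3 / 2 * e -> 0 <= e ->
    c ^+ 2 * p <= 5 / 32 * e -> c ^+ 2 * q <= 5 / 32 * e ->
    y <= 8 / 15 * p + 8 / 15 * q -> c * x + c ^+ 2 * y <= 2 * e.
  move=> x_le e0 p_le q_le y_le; have := ler_wpM2l (sqr_ge0 c) y_le.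
  by rewrite mulrDr [_ * (_ * p)]mulrCA [_ * (_ * q)]mulrCA; lra.
have le_normc (c : R) (x y : R[i]) : 0 <= c ->
    normc (- c%:C * x + c%:C ^+ 2 * y) <= c * normc x + c ^+ 2 * normc y.
  move=> c0; apply: le_trans (le_normcD _ _) _.
  by rewrite normcM normcN expr2 !normcM (normc_real c0).
rewrite invmx_coremx_mul hdotDl hdotZl hdotZl.
rewrite (adjmx_selfadjoint (invmx _ *m _)).
apply: le_trans (le_normc _ _ _ (ltW (coupling_gt0 R K))) _.
have ev : energy k (fun i => normc (v i 0)) = energy k (fun i => normc (u i 0)).
  by apply: eq_bigr => i _; rewrite uv.
apply: combine (hdot_adjmx_le k uv) (energy_ge0 _ _)
  (enorm_adjmx_energy k u) _ _.
  by rewrite -ev; apply: enorm_adjmx_energy.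
apply: amgm (normc_hdot _ _) _ (enorm_ge0 _).
have := enorm_coremx_ge (invmx (coremx R K) *m (adjmx R K *m u)).
by rewrite mulKVmx ?coremx_unit.
Qed.

Lemma hdot_coremx_le (R : realType) (K k : nat) (u v : 'cV[R[i]]_(dim K)) :
  (forall i, normc (u i 0) = normc (v i 0)) ->
  normc (hdot ((coremx R K - 1%:M) *m u) v) <=
  2 * energy k (fun i => normc (u i 0)).
Proof.
move=> uv; rewrite /coremx addrAC subrr add0r -scalemxAl hdotZl normcM.
rewrite (normc_real (ltW (coupling_gt0 R K))).
apply: le_trans (hdot_adjmx_le k uv) _.
by rewrite ler_wpM2r ?energy_ge0//; lra.
Qed.

(** * Bounding and evaluating the suprema *)

Lemma exists_enorm1 (R : realType) (n : nat) :
  exists h : 'cV[R[i]]_n.+1, enorm h = 1.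
Proof.
exists (delta_mx 0 0); rewrite enormE (bigD1 0)//= big1 ?addr0.
  by rewrite mxE eqxx normc1 expr1n sqrtr1.
by move=> i i0; rewrite mxE (negbTE i0) normc0 expr0n.
Qed.

Lemma numradius_le (R : realType) (n : nat) (A : 'M[R[i]]_n.+1) (x : R) :
  (forall h, enorm h = 1 -> normc (hdot (A *m h) h) <= x) -> numradius A <= x.
Proof.
move=> A_le; apply: ge_sup.
  have [h h1] := exists_enorm1 R n.
  by exists (complex.Re `|hdot (A *m h) h|); exists h.
by move=> _ [h h1 <-]; rewrite Re_normE; apply: A_le.
Qed.

Lemma opnorm_eq (R : realType) (n : nat) (A : 'M[R[i]]_n) (x : R)
    (h : 'cV[R[i]]_n) :
  (forall u, enorm u = 1 -> enorm (A *m u) <= x) ->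
  enorm h = 1 -> enorm (A *m h) = x -> opnorm A = x.
Proof.
move=> A_le h1 Ah; rewrite /opnorm; set S := (X in sup X).
have x_ub : ubound S x by move=> _ [u u1 <-]; apply: A_le.
have xS : S x by exists h.
apply: le_anti; rewrite ge_sup//=; last by exists x.
by apply: ub_le_sup => //; exists x.
Qed.

(** * Multiplication by D or its inverse on both sides *)

(** The value [false] of [s] gives D, [true] its inverse, so that one argument serves both A and
    A^-1. *)
Definition twist (R : realType) (K : nat) (s : bool) : 'M[R[i]]_(dim K) :=
  diag_mx (\row_j cis ((-1) ^+ s * angle R K j)).

Lemma twistE (R : realType) (K : nat) (s : bool) (u : 'cV[R[i]]_(dim K)) i :
  (twist R K s *m u) i 0 = cis ((-1) ^+ s * angle R K i) * u i 0.
Proof. by rewrite mul_diag_mx !mxE. Qed.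

Lemma enorm_twist (R : realType) (K : nat) (s : bool) (u : 'cV[R[i]]_(dim K)) :
  enorm (twist R K s *m u) = enorm u.
Proof. by apply: enorm_eq => i; rewrite twistE normcM normc_cis mul1r. Qed.

Lemma conjcM (R : realType) (x y : R[i]) :
  conjc (x * y) = conjc x * conjc y.
Proof. exact: rmorphM. Qed.

Lemma cis_conj (R : realType) (t : R) : cis t * conjc (cis t) = 1.
Proof. by rewrite mulcJ normc_cis expr1n. Qed.

Lemma twistK (R : realType) (K : nat) (s : bool) :
  twist R K s *m twist R K (~~ s) = 1%:M.
Proof.
rewrite mulmx_diag -diag_const_mx; congr diag_mx; apply/rowP => j; rewrite !mxE.
by rewrite signrN mulNr cisN cis_conj.
Qed.

Lemma hdot_twist (R : realType) (K : nat) (s : bool) (u v : 'cV[R[i]]_(dim K)) :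
  hdot (twist R K s *m u) v = hdot u (twist R K (~~ s) *m v).
Proof.
rewrite !hdotE; apply: eq_bigr => i _.
by rewrite !twistE signrN mulNr cisN conjcM conjcK [RHS]mulrCA mulrA.
Qed.

Lemma Re_cis_sqr (R : realType) (t x : R) :
  complex.Re (cis t * cis t * x%:C) = (1 - 2 * sin t ^+ 2) * x.
Proof.
rewrite /cis; simpc => /=.
by rewrite -[X in _ = (X - _) * _](cos2Dsin2 t); ring.
Qed.

(** After rotation the form is <M u, v>. Its identity part has real part 1 - 2 Q, as exp (2 i t) has
    real part 1 - 2 sin^2 t, and the hypothesis bounds the remainder by 2 Q. *)
Lemma numradius_twist (R : realType) (K : nat) (s : bool)
    (M : 'M[R[i]]_(dim K)) :
  (forall k (u v : 'cV[R[i]]_(dim K)),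
    (forall i, normc (u i 0) = normc (v i 0)) ->
    normc (hdot ((M - 1%:M) *m u) v) <=
    2 * energy k (fun i => normc (u i 0))) ->
  numradius (twist R K s *m M *m twist R K s) <= 1 / cos (pi / (dim K)%:R).
Proof.
move=> M_le; apply: numradius_le => h h1.
apply: (normc_le_ngon (s := s)); first lia.
(* Half the rotation angle: [u] and [v] each take one half, which shifts their phases from t_i to
   t_(i+k). *)
move=> k; set t : R := (-1) ^+ s * (k%:R * pi / (dim K)%:R).
pose u := cis t *: (twist R K s *m h).
pose v := conjc (cis t) *: (twist R K (~~ s) *m h).
have uE i : u i 0 = cis ((-1) ^+ s * angle R K (i + k)) * h i 0.
  by rewrite mxE twistE mulrA -cisD -mulrDr angleD addrC.
have vE i : v i 0 = conjc (cis ((-1) ^+ s * angle R K (i + k))) * h i 0.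
  rewrite mxE twistE mulrA signrN mulNr -!cisN -cisD -opprD -mulrDr angleD.
  by rewrite [angle _ _ _ + _]addrC.
have norm_u i : normc (u i 0) = normc (h i 0).
  by rewrite uE normcM normc_cis mul1r.
have norm_v i : normc (v i 0) = normc (h i 0).
  by rewrite vE normcM normc_conjc normc_cis mul1r.
have -> : cis ((-1) ^+ s * (2 * k%:R * pi / (dim K)%:R)) *
    hdot (twist R K s *m M *m twist R K s *m h) h = hdot (M *m u) v.
  rewrite -!mulmxA hdot_twist /u /v -scalemxAr hdotZl hdotZr conjcK mulrA.
  by rewrite -cisD /t -mulrDr; congr (cis (_ * _) * _); ring.
have -> : M *m u = (M - 1%:M) *m u + u by rewrite mulmxBl mul1mx subrK.
rewrite hdotDl.
have Re_uv : complex.Re (hdot u v) = 1 - 2 * energy k (fun i => normc (u i 0)).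
  have h2 : \sum_i normc (h i 0) ^+ 2 = 1 by rewrite -enorm_sqr h1 expr1n.
  rewrite -[X in _ = X - _]h2.
  rewrite hdotE Re_sum /energy mulr_sumr -sumrB; apply: eq_bigr => i _.
  rewrite norm_u uE vE conjcM conjcK mulrACA mulcJ.
  have -> : sin2 R K (i + k) = sin ((-1) ^+ s * angle R K (i + k)) ^+ 2.
    by case: (s); rewrite ?expr0 ?expr1 ?mul1r ?mulN1r ?sinN ?sqrrN.
  by rewrite Re_cis_sqr mulrBl mul1r -mulrA.
have uv i : normc (u i 0) = normc (v i 0) :=
  etrans (norm_u i) (esym (norm_v i)).
have Re_add_le (x y : R[i]) (e : R) :
    complex.Re x <= e -> complex.Re y = 1 - e -> complex.Re (x + y) <= 1.
  by case: x y => [a b] [a' b'] /= ? ?; lra.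
exact: Re_add_le (le_trans (Re_le_normc _) (M_le k u v uv)) Re_uv.
Qed.

Lemma opnorm_twist_coremx (R : realType) (K : nat) :
  opnorm (twist R K false *m coremx R K *m twist R K false) =
  1 + 1 / (8 * Num.sqrt (dim K)%:R).
Proof.
set x := 1 + _.
have [n0 s0] : 0 < (dim K)%:R :> R /\ 0 < Num.sqrt (dim K)%:R :> R.
  by rewrite sqrtr_gt0 ltr0n.
have x0 : 0 <= x by rewrite addr_ge0 ?divr_ge0 ?mulr_ge0 ?ltW.
(* A unit eigenvector of B, all row sums of E being n / 4; its image under D^-1 attains the norm. *)
pose e : 'cV[R[i]]_(dim K) := const_mx ((Num.sqrt (dim K)%:R)^-1)%:C.
have e1 : enorm e = 1.
  rewrite enormE; under eq_bigr => i _.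
    rewrite mxE normc_real ?invr_ge0 ?(ltW s0)// exprVn sqr_sqrtr ?(ltW n0)//.
    over.
  by rewrite sumr_const card_ord -[_ *+ _]mulr_natr mulVf ?gt_eqF// sqrtr1.
have Be : coremx R K *m e = x%:C *: e.
  rewrite coremx_mul -[X in X + _]scale1r /x rmorphD /= [RHS]scalerDl.
  congr (_ + _).
  rewrite -coupling_degree rmorphM -scalerA; congr (_ *: _); apply/colP => i.
  rewrite !mxE; under eq_bigr => j _ do rewrite !mxE.
  rewrite -mulr_suml -(adj_degreeR R i); congr (_ * _).
  by rewrite rmorph_sum; apply: eq_bigr => j _; rewrite rmorph_nat.
apply: (@opnorm_eq _ _ _ _ (twist R K true *m e)).
- move=> u u1; rewrite -!mulmxA enorm_twist.
  by apply: le_trans (enorm_coremx_le _) _; rewrite enorm_twist u1 mulr1.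
- by rewrite enorm_twist.
rewrite -!mulmxA (mulmxA (twist R K false) (twist R K true)) (twistK R K false).
by rewrite mul1mx Be enorm_twist enormZ e1 mulr1 normc_real.
Qed.

(** * Assembling A = D B D and its inverse *)

Theorem theorem1p3 (R : realType) (n : nat) (k : int)
    (n_gt0 : (0 < n)%N) (n_eq : n%:Z = 8 * k + 4) :
  exists A : 'M[R[i]]_n,
    [/\ A \in unitmx,
        numradius A <= 1 / cos (pi / n%:R),
        numradius (invmx A) <= 1 / cos (pi / n%:R)
      & opnorm A = 1 + 1 / (8 * Num.sqrt n%:R)].
Proof.
(* Positivity of [n] forces [k] to be nonnegative, so its absolute value is [k] itself. *)
have [K nK] : exists K, n = dim K by exists `|k|%N; lia.
move: n_gt0 n_eq; rewrite {n}nK => _ _.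
pose B := coremx R K; pose D := twist R K false; pose D' := twist R K true.
have DD' : D *m D' = 1%:M := twistK R K false.
have D'D : D' *m D = 1%:M := twistK R K true.
(* For square matrices a right inverse settles invertibility and identifies A^-1, which has the
   twisted form with the opposite sign. *)
have AV : (D *m B *m D) *m (D' *m invmx B *m D') = 1%:M.
  rewrite !mulmxA -(mulmxA _ D D') DD' mulmx1 -(mulmxA D B).
  by rewrite mulmxV ?coremx_unit// mulmx1.
have [A_unit _] := mulmx1_unit AV.
have invA : invmx (D *m B *m D) = D' *m invmx B *m D'.
  by rewrite -[RHS](mulKmx A_unit) AV mulmx1.
exists (D *m B *m D); split=> //.
- by apply: numradius_twist => j u v; apply: hdot_coremx_le.
- rewrite invA; apply: numradius_twist => j u v; exact: hdot_invmx_coremx_le.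
exact: opnorm_twist_coremx.
Qed.
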